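(* Let $0<p\le 1\le q$, and let $f$ be a continuous real-valued function on $[0,\infty)$ that satisfies one of the following inequalities for any positive definite matrices $A$ and $B$ (complex, of the same arbitrary size $n\times n$): (i) $$f\left(\frac{A+B}{2}\right)\le f\left(A^{1/2} f_{\mu,q}\left(A^{-1/2}BA^{-1/2}\right)A^{1/2}\right);$$ (ii) $$f\left(A^{1/2} f_{\mu,p}\left(A^{-1/2}BA^{-1/2}\right)A^{1/2}\right)\le f\left(\frac{A+B}{2}\right).$$ Then $f$ is operator monotone on $(0,\infty)$.
   Context: For Hermitian matrices, $X\le Y$ means that $Y-X$ is positive semidefinite (Loewner order), and $f(X)$ is defined by the functional calculus. For $s>0$ and $t>0$, $f_{\mu,s}(t)=\left(\frac{1+t^s}{2}\right)^{1/s}$. A continuous function $f$ is operator monotone on $I\subset\mathbb{R}$ if, for any Hermitian matrices $A$ and $B$ (complex, of the same arbitrary size) with spectra in $I$, $A\le B$ implies $f(A)\le f(B)$.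
   Formalization: The formal theorem requires q > 1 when inequality (i) is assumed and p < 1 when (ii) is assumed: for q = 1 (resp. p = 1) the inequality reads f((A+B)/2) ≤ f((A+B)/2), true for every f, e.g. f(t) = -t, which is not operator monotone. *)

(* Defs.v *)
From HB Require Import structures.
From mathcomp Require Import all_boot all_order all_algebra.
From mathcomp Require Import complex.
From mathcomp Require Import all_classical all_reals all_analysis.

Set Implicit Arguments.
Unset Strict Implicit.
Unset Printing Implicit Defensive.

Import Order.TTheory GRing.Theory Num.Theory.
Import numFieldNormedType.Exports.

Local Open Scope classical_set_scope.
Local Open Scope ring_scope.
Local Open Scope sesquilinear_scope.
Local Open Scope complex_scope.

(* The order on [R[i]] used below is the partial one of a numClosedFieldType:
   [0 <= z] (resp. [0 < z]) says that z is real and nonnegative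
   (resp. positive). *)
Definition psdmx (R : realType) (n : nat) (A : 'M[R[i]]_n) : Prop :=
  A \is hermsymmx /\ forall x : 'cV[R[i]]_n, 0 <= (x ^t* *m A *m x) 0 0.

Definition posdefmx (R : realType) (n : nat) (A : 'M[R[i]]_n) : Prop :=
  A \is hermsymmx /\
  forall x : 'cV[R[i]]_n, x != 0 -> 0 < (x ^t* *m A *m x) 0 0.

Definition loewner_le (R : realType) (n : nat) (X Y : 'M[R[i]]_n) : Prop :=
  psdmx (Y - X).

(* For Hermitian A the eigenvalues [spectral_diag A] are real, so that taking
   their real parts loses nothing, and A = P^-1 D P with P = [spectralmx A]
   unitary and D = [diag_mx (spectral_diag A)]. *)
Definition mxfun (R : realType) (f : R -> R) (n : nat) (A : 'M[R[i]]_n) :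
    'M[R[i]]_n :=
  invmx (spectralmx A)
    *m diag_mx (map_mx (fun z : R[i] => (f (complex.Re z))%:C) (spectral_diag A))
    *m spectralmx A.

Definition spectrum_in (R : realType) (n : nat) (I : set R)
    (A : 'M[R[i]]_n) : Prop :=
  forall z : R[i], eigenvalue A z -> exists2 t : R, I t & z = t%:C.

Definition operator_monotone (R : realType) (I : set R) (f : R -> R) : Prop :=
  {within I, continuous f} /\
  forall (n : nat) (A B : 'M[R[i]]_n),
    A \is hermsymmx -> B \is hermsymmx ->
    spectrum_in I A -> spectrum_in I B ->
    loewner_le A B -> loewner_le (mxfun f A) (mxfun f B).

Definition f_mu (R : realType) (s t : R) : R :=
  ((1 + t `^ s) / 2) `^ (s^-1).

Definition mxpow (R : realType) (r : R) (n : nat) (A : 'M[R[i]]_n) :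
    'M[R[i]]_n :=
  mxfun (fun t : R => t `^ r) A.

Definition mu_mean (R : realType) (s : R) (n : nat) (A B : 'M[R[i]]_n) :
    'M[R[i]]_n :=
  mxpow (2^-1) A
    *m mxfun (f_mu s) (mxpow (- 2^-1) A *m B *m mxpow (- 2^-1) A)
    *m mxpow (2^-1) A.

Definition arith_mean (R : realType) (n : nat) (A B : 'M[R[i]]_n) :
    'M[R[i]]_n :=
  (2^-1 : R[i]) *: (A + B).

(* Main.v *)
(** The congruence [X |-> S X S^*] commutes with both means, so means of
    commuting matrices suffice.  For x in ]0, 1] the arithmetic mean of x and
    2 - x is 1, while their power mean of order s takes all values between 1
    and its limit 2^(1 - 1/s) at x = 0; a simultaneous diagonalization by
    congruence thus writes any A <= B with B < kappa A, for a suitable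
    kappa > 1, as the two means of one pair of positive definite matrices, and
    the hypothesis gives f(A) <= f(B).  For general A <= B, go along the segment
    from A to B in steps so small that consecutive points satisfy the
    restriction. *)
Require Import Defs.
From HB Require Import structures.
From mathcomp Require Import all_boot all_order all_algebra.
From mathcomp Require Import complex.
From mathcomp Require Import ring lra.
From mathcomp Require Import all_classical all_reals all_analysis.
Import Order.TTheory GRing.Theory Num.Theory.
Import numFieldNormedType.Exports.
Local Open Scope classical_set_scope.
Local Open Scope ring_scope.
Local Open Scope complex_scope.

(** * Congruences of real diagonal matrices, and simultaneous diagonalization *)

Section Congruence.
Set Implicit Arguments.
Unset Strict Implicit.
Variables (R : realType) (n : nat).
Local Open Scope sesquilinear_scope.
Implicit Types (A B S U : 'M[R[i]]_n) (d e : 'I_n -> R).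

Definition rdiag d : 'M[R[i]]_n := diag_mx (\row_i (d i)%:C).

(** [S] need not be unitary. For unitary [S] the entries of [d] are the eigenvalues; for invertible
    [S] they only diagonalize the Hermitian form, which is enough for signs and for the means. *)
Definition congdiag S d : 'M[R[i]]_n := S *m rdiag d *m S^t*.

Lemma rdiagM d e : rdiag d *m rdiag e = rdiag (fun i => d i * e i).
Proof.
by rewrite mulmx_diag; congr diag_mx; apply/rowP => i; rewrite !mxE rmorphM.
Qed.

Lemma rdiag1 : rdiag (fun=> 1) = 1%:M.
Proof.
rewrite -diag_const_mx; congr diag_mx; apply/rowP => i.
by rewrite !mxE rmorph1.
Qed.

Lemma rdiag_tC d : (rdiag d)^t* = rdiag d.
Proof.
rewrite tr_diag_mx map_diag_mx; congr diag_mx; apply/rowP => i.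
by rewrite !mxE; apply: conj_Creal; apply/complex_realP; exists (d i).
Qed.

Lemma trmxC_mul m k l (X : 'M[R[i]]_(m, k)) (Y : 'M[R[i]]_(k, l)) :
  (X *m Y)^t* = Y^t* *m X^t*.
Proof. by rewrite trmx_mul map_mxM. Qed.

Lemma unitmx_tC S : (S^t* \in unitmx) = (S \in unitmx).
Proof. by rewrite map_unitmx unitmx_tr. Qed.

Lemma hermsymmxE A : (A \is hermsymmx) = (A == A^t*).
Proof. by rewrite is_hermitianmxE expr0 scale1r. Qed.

Lemma herm_congr S A : A \is hermsymmx -> S *m A *m S^t* \is hermsymmx.
Proof.
rewrite !hermsymmxE => /eqP AE.
by rewrite !trmxC_mul trmxCK -AE mulmxA.
Qed.

Lemma congdiag_herm S d : congdiag S d \is hermsymmx.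
Proof. by apply: herm_congr; rewrite hermsymmxE rdiag_tC. Qed.

Lemma congdiagD S d e :
  congdiag S d + congdiag S e = congdiag S (fun i => d i + e i).
Proof.
rewrite /congdiag -mulmxDl -mulmxDr; congr (_ *m _ *m _).
by rewrite -raddfD; congr diag_mx; apply/rowP => i; rewrite !mxE rmorphD.
Qed.

Lemma congdiagZ S (r : R) d :
  r%:C *: congdiag S d = congdiag S (fun i => r * d i).
Proof.
rewrite /congdiag scalemxAl scalemxAr; congr (_ *m _ *m _).
rewrite -[r%:C *: _]linearZ; congr diag_mx; apply/rowP => i.
by rewrite !mxE rmorphM.
Qed.

Lemma congdiag_form S d (x : 'cV[R[i]]_n) :
  (x^t* *m congdiag S d *m x) 0 0 =
  \sum_i (d i)%:C * `|(S^t* *m x) i 0| ^+ 2.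
Proof.
rewrite /congdiag; set y := S^t* *m x.
have -> : x^t* *m (S *m rdiag d *m S^t*) *m x = y^t* *m (rdiag d *m y).
  by rewrite /y trmxC_mul trmxCK !mulmxA.
rewrite mxE; apply: eq_bigr => i _.
by rewrite mul_diag_mx !mxE normCK mulrC -mulrA.
Qed.

Lemma congdiag_posdef S d : S \in unitmx -> (forall i, 0 < d i) ->
  posdefmx (congdiag S d).
Proof.
move=> Su d_gt0; split=> [|x x_neq0]; first exact: congdiag_herm.
have d_ge0 i : 0 <= (d i)%:C :> R[i] by rewrite lecR ltW.
rewrite congdiag_form lt_def sumr_ge0 ?andbT; last first.
  by move=> i _; rewrite mulr_ge0 ?exprn_ge0.
apply: contra x_neq0; rewrite psumr_eq0; last first.
  by move=> i _; rewrite mulr_ge0 ?exprn_ge0.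
move=> /allP y0; suff y_eq0 : S^t* *m x = 0.
  by rewrite -[x](mulKmx (_ : S^t* \in unitmx)) ?unitmx_tC// y_eq0 mulmx0.
apply/colP => i; have := y0 i (mem_index_enum i).
have di_neq0 : (d i)%:C != 0 :> R[i] by rewrite gt_eqF// ltcR.
by rewrite /= mulf_eq0 (negbTE di_neq0) expf_eq0 normr_eq0 [in RHS]mxE => /eqP.
Qed.

(** The vector [x] is chosen so that [S^t* *m x] is the [i]-th basis vector; testing the form on it
    isolates one diagonal entry. *)
Lemma congdiag_coef S d i (x := invmx (S^t*) *m delta_mx i 0 : 'cV_n) :
  S \in unitmx -> (x^t* *m congdiag S d *m x) 0 0 = (d i)%:C.
Proof.
move=> Su; rewrite congdiag_form mulKVmx ?unitmx_tC// (bigD1 i) //= big1.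
  by rewrite mxE !eqxx normr1 expr1n mulr1 addr0.
by move=> j ji; rewrite mxE (negbTE ji) normr0 expr0n mulr0.
Qed.

Lemma psd_congdiag S d : S \in unitmx -> psdmx (congdiag S d) ->
  forall i, 0 <= d i.
Proof. by move=> Su [_ psd] i; rewrite -lecR -(congdiag_coef d i Su). Qed.

Lemma posdef_congdiag S d : S \in unitmx -> posdefmx (congdiag S d) ->
  forall i, 0 < d i.
Proof.
move=> Su [_ pos] i; rewrite -ltcR -(congdiag_coef d i Su); apply: pos.
apply/eqP => /(congr1 (mulmx (S^t*))); rewrite mulKVmx ?unitmx_tC// mulmx0.
by move/matrixP/(_ i 0)/eqP; rewrite !mxE !eqxx oner_eq0.
Qed.

(* If D = diag(d) and P^-1 E P is the spectral decomposition of U D U^*, then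
   W = P U intertwines E and D; as [W i j != 0] forces [e_i = d_j], W also
   intertwines f(E) and f(D). *)
Lemma mxfun_congdiag (f : R -> R) U d : U \is unitarymx ->
  mxfun f (congdiag U d) = congdiag U (fun i => f (d i)).
Proof.
move=> Uu; have /hermitian_normalmx/orthomx_spectralP := congdiag_herm U d.
set A := congdiag U d; rewrite /mxfun.
have := spectral_unit A; move: (spectralmx A) (spectral_diag A) => P e Pu AE.
have comW : diag_mx e *m (P *m U) = P *m U *m rdiag d.
  rewrite -(mulmxKtV (P *m U *m _) Uu)// -[_ *m _ *m U^t*]mulmxA.
  have -> : P *m U *m (rdiag d *m U^t*) = P *m A by rewrite !mulmxA.
  by rewrite AE !mulmxA mulmxV ?mul1mx.
have comfW : diag_mx (map_mx (fun z => (f (complex.Re z))%:C) e) *m (P *m U)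
    = P *m U *m rdiag (f \o d).
  apply/matrixP => i j; move/matrixP/(_ i j): comW.
  rewrite !mul_diag_mx !mul_mx_diag !mxE.
  have [->|w_neq0] := eqVneq (\sum_k P i k * U k j) 0.
    by move=> _; rewrite mulr0 mul0r.
  by rewrite mulrC => /(mulfI w_neq0) ->; rewrite mulrC.
set F := diag_mx _ in comfW *.
(* The identity [U *m U^t*] is inserted so that [P *m U] appears and the intertwining relation
   applies. *)
have -> : invmx P *m F *m P = invmx P *m (F *m (P *m U)) *m U^t*.
  by rewrite !mulmxA (mulmxtVK _ Uu).
by rewrite comfW !mulmxA mulVmx ?mul1mx.
Qed.

Lemma herm_congdiag A : A \is hermsymmx ->
  exists2 U, U \is unitarymx & exists2 d : 'I_n -> R, A = congdiag U d &
    forall i, eigenvalue A (d i)%:C.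
Proof.
move=> Ah; have /hermitian_normalmx/orthomx_spectralP := Ah.
have := hermitian_spectral_diag_real Ah; have := spectral_unitarymx A.
move: (spectralmx A) (spectral_diag A) => P e Pu /mxOverP eR AE.
have eE i : (complex.Re (e 0 i))%:C = e 0 i by apply/RRe_real/eR.
exists (P^t*); first by rewrite trmxC_unitary.
exists (fun i => complex.Re (e 0 i)) => [|i].
  rewrite /congdiag (trmxCK P) [LHS]AE (invmx_unitary Pu).
  congr (_ *m diag_mx _ *m _).
  by apply/rowP => i; rewrite !mxE eE.
(* Eigenvectors are row vectors here, so a row of [P] is a witness; it is nonzero because
   [P *m P^t*] has diagonal entries 1. *)
rewrite eE; apply/eigenvalueP; exists (row i P).
  rewrite -row_mul AE !mulmxA mulmxV ?unitarymx_unit// mul1mx.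
  by apply/rowP => j; rewrite mul_diag_mx !mxE.
apply/eqP => Pi0; have /unitarymxP/matrixP/(_ i i) := Pu.
rewrite !mxE eqxx big1 => [/eqP|k _]; first by rewrite eq_sym oner_eq0.
by move/rowP/(_ k): Pi0; rewrite !mxE => ->; rewrite mul0r.
Qed.

(** Factor [A] as [T *m T^t*], diagonalize the Hermitian matrix [invmx T *m B *m (invmx T)^t*] by a
    unitary [V], and take [S = T *m V]: the factor [V] cancels in [S *m S^t*]. *)
Lemma simultaneous_congdiag A B : A \is hermsymmx -> B \is hermsymmx ->
  spectrum_in `]0, +oo[ A ->
  exists2 S, S \in unitmx &
    A = congdiag S (fun=> 1) /\ exists d, B = congdiag S d.
Proof.
move=> Ah Bh Apos; have [U Uu [a AE eA]] := herm_congdiag Ah.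
have a_gt0 i : 0 < a i.
  by have [t /=] := Apos _ (eA i); rewrite in_itv /= andbT => ? /complexI ->.
pose T := U *m rdiag (fun i => Num.sqrt (a i)).
have TT : T *m T^t* = A.
  rewrite AE /T trmxC_mul rdiag_tC mulmxA -(mulmxA U) rdiagM.
  congr (_ *m rdiag _ *m _); apply/funext => i.
  by rewrite -expr2 sqr_sqrtr// ltW.
have Tu : T \in unitmx.
  rewrite unitmx_mul unitarymx_unit//=.
  suff /mulmx1_unit[-> _] : rdiag (fun i => Num.sqrt (a i)) *m
      rdiag (fun i => (Num.sqrt (a i))^-1) = 1%:M by [].
  rewrite rdiagM -rdiag1; congr rdiag; apply/funext => i.
  by rewrite divff// gt_eqF// sqrtr_gt0.
have Ch := herm_congr (invmx T) Bh.
have [V Vu [d CE _]] := herm_congdiag Ch.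
exists (T *m V); first by rewrite unitmx_mul Tu unitarymx_unit.
split; last exists d; rewrite /congdiag trmxC_mul.
  by rewrite rdiag1 mulmx1 mulmxA -(mulmxA T) (unitarymxP Vu) mulmx1 TT.
have -> : T *m V *m rdiag d *m (V^t* *m T^t*) = T *m congdiag V d *m T^t*.
  by rewrite /congdiag !mulmxA.
rewrite -CE !mulmxA mulmxV// mul1mx -mulmxA -trmxC_mul mulmxV//.
by rewrite trmx1 map_mx1 mulmx1.
Qed.

(** * The two means of matrices diagonalized by one congruence *)

Lemma mxpowE r U d : U \is unitarymx ->
  mxpow r (congdiag U d) = congdiag U (fun i => d i `^ r).
Proof. exact: mxfun_congdiag. Qed.

(* T = X^(-1/2) S D^(1/2), with X = S D S^*, is unitary. *)
Lemma mu_mean_congdiag (s : R) S d e : S \in unitmx -> (forall i, 0 < d i) ->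
  mu_mean s (congdiag S d) (congdiag S e) =
  congdiag S (fun i => d i * f_mu s (e i / d i)).
Proof.
move=> Su d_gt0; set X := congdiag S d.
have [U Uu [x]] := herm_congdiag (congdiag_herm S d); rewrite -/X => XE _.
(* Positive definiteness of [X], known through [S], is read off again in the orthonormal eigenbasis
   [U]. *)
have x_gt0 : forall i, 0 < x i.
  apply: (posdef_congdiag (unitarymx_unit Uu)).
  by rewrite -XE; apply: congdiag_posdef.
have powE r : mxpow r X = congdiag U (fun i => x i `^ r).
  by rewrite XE mxpowE.
have powM r t : mxpow r X *m mxpow t X = mxpow (r + t) X.
  rewrite !powE /congdiag !mulmxA (mulmxKtV _ Uu)// -(mulmxA U) rdiagM.
  congr (_ *m rdiag _ *m _); apply/funext => i.
  by rewrite powRD// (gt_eqF (x_gt0 i)) implybT.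
have pow0 : mxpow 0 X = 1%:M.
  rewrite powE /congdiag; under eq_fun do rewrite powRr0.
  by rewrite rdiag1 mulmx1 (unitarymxP Uu).
have pow1 : mxpow 1 X = X.
  rewrite powE [RHS]XE; congr congdiag; apply/funext => i.
  by rewrite powRr1// ltW.
have half : 2^-1 + 2^-1 = 1 :> R by lra.
rewrite /mu_mean -/X; set Y := mxpow (- 2^-1) X; set Z := mxpow 2^-1 X.
have YC : Y^t* = Y.
  by rewrite /Y powE; apply/esym/eqP; rewrite -hermsymmxE congdiag_herm.
have ZY : Z *m Y = 1%:M by rewrite powM subrr.
have YZ : Y *m Z = 1%:M by rewrite powM addNr.
have YXY : Y *m X *m Y = 1%:M.
  rewrite -[in X in _ *m X *m _]pow1 !powM (_ : _ + _ = 0) ?pow0//.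
  by rewrite -{2}half addrA addNr add0r subrr.
move: Y Z YC ZY YZ YXY => Y Z YC ZY YZ YXY.
pose D := rdiag (fun i => d i `^ 2^-1).
have DDE g : D *m rdiag g *m D = rdiag (fun i => d i * g i).
  rewrite !rdiagM; congr rdiag; apply/funext => i.
  rewrite mulrAC -powRD ?half ?powRr1 ?ltW//.
  by rewrite (gt_eqF (d_gt0 i)) implybT.
pose T := Y *m S *m D.
(* For [g = 1] the right-hand side is [Y *m X *m Y], the identity, so [T] is unitary; for
   [g = e / d] it is the matrix to which the mean applies [f_mu s]. *)
have TE g : congdiag T g = Y *m congdiag S (fun i => d i * g i) *m Y.
  by rewrite /congdiag -DDE !trmxC_mul rdiag_tC YC !mulmxA.
have Tu : T \is unitarymx.
  apply/unitarymxP.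
  have -> : T *m T^t* = congdiag T (fun=> 1) by rewrite /congdiag rdiag1 mulmx1.
  by rewrite TE; under eq_fun do rewrite mulr1.
have -> : Y *m congdiag S e *m Y = congdiag T (fun i => e i / d i).
  rewrite TE (_ : (fun i => d i * _) = e)//; apply/funext => i.
  by rewrite mulrCA divff ?mulr1// gt_eqF.
by rewrite mxfun_congdiag// TE !mulmxA ZY mul1mx -mulmxA YZ mulmx1.
Qed.

Lemma arith_mean_congdiag S d e :
  arith_mean (congdiag S d) (congdiag S e) =
  congdiag S (fun i => (d i + e i) / 2).
Proof.
rewrite /arith_mean congdiagD -(rmorph_nat (real_complex R)) -fmorphV congdiagZ.
by congr congdiag; apply/funext => i; rewrite mulrC.
Qed.

(** * The Loewner order along finite chains *)

Lemma loewner_refl A : loewner_le A A.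
Proof.
rewrite /loewner_le subrr; split=> [|x].
  by rewrite hermsymmxE trmx0 map_mx0.
by rewrite mulmx0 mul0mx mxE.
Qed.

Lemma psdmxD A B : psdmx A -> psdmx B -> psdmx (A + B).
Proof.
move=> [Ah Apos] [Bh Bpos].
split=> [|x]; last by rewrite mulmxDr mulmxDl mxE addr_ge0.
move: Ah Bh; rewrite !hermsymmxE linearD map_mxD /= => /eqP <- /eqP <-.
by rewrite eqxx.
Qed.

Lemma loewner_trans A B C : loewner_le A B -> loewner_le B C -> loewner_le A C.
Proof.
move=> AB BC; rewrite /loewner_le.
have -> : C - A = (C - B) + (B - A) by rewrite addrA subrK.
exact: psdmxD BC AB.
Qed.

Lemma loewner_chain (X : nat -> 'M[R[i]]_n) N :
  (forall k, (k < N)%N -> loewner_le (X k) (X k.+1)) -> loewner_le (X 0) (X N).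
Proof.
elim: N => [_|N IH step]; first exact: loewner_refl.
by apply: loewner_trans (step N _) => //; apply: IH => k /ltnW/step.
Qed.

End Congruence.

(** * Scalar power means, and pairs of matrices with prescribed means *)

Section PowerMean.
Set Implicit Arguments.
Unset Strict Implicit.
Variable (R : realType).
Implicit Types s c x : R.

Lemma powR_cts s x : 0 < x -> {for x, continuous (fun x : R => x `^ s)}.
Proof.
move=> x_gt0; apply: differentiable_continuous.
by apply/derivable1_diffP/derivable_powR; rewrite in_itv /= x_gt0.
Qed.

(** The endpoint 0 is outside the reach of [powR_cts]; there the value is 0, which is the right
    limit because [s] is positive. *)
Lemma powR_cts_itv01 s : 0 < s ->
  {within `[0, 1], continuous (fun x : R => x `^ s)}.
Proof.
move=> s_gt0; apply/continuous_within_itvP => //; split.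
- by move=> x; rewrite in_itv /= => /andP[x_gt0 _]; apply: powR_cts.
- by rewrite powR0 ?gt_eqF//; apply: powR_cvg0.
- by apply: cvg_at_left_filter; apply: powR_cts.
Qed.

(* Up to the power s, the power mean of x and 2 - x is 2^(s-1) at x = 0 and 1 at
   x = 1. *)
Lemma power_mean_surj s c : 0 < s -> 0 < c ->
  2 `^ (s - 1) < c `^ s <= 1 \/ 1 <= c `^ s < 2 `^ (s - 1) ->
  exists2 x, 0 < x < 2 & x * f_mu s ((2 - x) / x) = c.
Proof.
move=> s_gt0 c_gt0 cs.
(* For [x] in ]0, 1], [h x] is twice the [s]-th power of the power mean of [x] and [2 - x]; the
   intermediate value theorem then solves for [c]. *)
pose h x := x `^ s + (2 - x) `^ s.
have h0 : h 0 = 2 * 2 `^ (s - 1).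
  by rewrite /h subr0 powR0 ?gt_eqF// add0r mulr_powRB1.
have h1 : h 1 = 2.
  by rewrite /h [2 - 1](_ : _ = 1) ?powR1//; lra.
have [x x01 hx] : exists2 x, x \in `[0, 1] & h x = 2 * c `^ s.
  apply: IVT => //.
    apply: (@within_continuousD _ _ _ _ (fun x => x `^ s)
      (fun x => (2 - x) `^ s)); first exact: powR_cts_itv01.
    apply: continuous_in_subspaceT => y.
    rewrite inE /= in_itv /= => /andP[_ y1].
    apply: (@continuous_comp _ _ _ (fun x => 2 - x) (fun x => x `^ s)).
      by apply: continuousB; [exact: cst_continuous|exact: id].
    by apply: powR_cts; lra.
  by rewrite h0 h1 ge_min le_max; case: cs => /andP[]; lra.
(* The mean divides by [x], so [x = 0] has to be excluded: the strict inequality in the hypothesis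
   does it. *)
move: x01; rewrite in_itv /= le_eqVlt => /andP[/orP[/eqP x0|x_gt0] x_le1].
  by move: hx; rewrite -x0 h0; case: cs => /andP[]; lra.
exists x; first by apply/andP; split => //; lra.
have y_gt0 : 0 < 2 - x by lra.
have -> : f_mu s ((2 - x) / x) = c / x; last first.
  by rewrite mulrCA divff ?mulr1// gt_eqF.
rewrite /f_mu; have -> : (1 + ((2 - x) / x) `^ s) / 2 = (c / x) `^ s.
  have xs : x `^ s != 0 by rewrite gt_eqF// powR_gt0.
  have xVs : x^-1 `^ s = (x `^ s)^-1.
    by rewrite -[x^-1]powR_inv1 ?ltW// -powRrM mulN1r powRN.
  rewrite !powRM ?invr_ge0 ?(ltW x_gt0) ?(ltW y_gt0) ?(ltW c_gt0)// xVs.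
  rewrite -[c `^ s](mulKf (_ : 2 != 0 :> R)) ?pnatr_eq0// -hx /h.
  by field.
by rewrite -powRrM divff ?gt_eqF// powRr1// divr_ge0// ltW.
Qed.

(** Both means act entrywise on a common congruence and are homogeneous. With [x i] chosen for the
    ratio [b i / a i], the entries [a i * x i] and [a i * (2 - x i)] have arithmetic mean [a i] and
    power mean [b i]. *)
Lemma exists_means s n (S : 'M[R[i]]_n) (a b : 'I_n -> R) : 0 < s ->
  S \in unitmx -> (forall i, 0 < a i) -> (forall i, 0 < b i) ->
  (forall i, 2 `^ (s - 1) < (b i / a i) `^ s <= 1 \/
             1 <= (b i / a i) `^ s < 2 `^ (s - 1)) ->
  exists X Y : 'M[R[i]]_n, [/\ posdefmx X, posdefmx Y,
    arith_mean X Y = congdiag S a & mu_mean s X Y = congdiag S b].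
Proof.
move=> s_gt0 Su a_gt0 b_gt0 ab.
have /choice[x xP] i : exists x,
    0 < x < 2 /\ x * f_mu s ((2 - x) / x) = b i / a i.
  have [|x ? ?] := power_mean_surj s_gt0 _ (ab i); first exact: divr_gt0.
  by exists x.
have x_gt0 i : 0 < a i * x i.
  by have [/andP[? _] _] := xP i; apply: mulr_gt0.
exists (congdiag S (fun i => a i * x i)).
exists (congdiag S (fun i => a i * (2 - x i))); split.
- exact: congdiag_posdef.
- apply: congdiag_posdef => // i; apply: mulr_gt0 => //.
  by rewrite subr_gt0; have [/andP[]] := xP i.
- rewrite arith_mean_congdiag; congr congdiag; apply/funext => i.
  by field.
- rewrite mu_mean_congdiag//; congr congdiag; apply/funext => i.
  have ai_neq0 : a i != 0 by rewrite gt_eqF.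
  by rewrite -mulf_div divff// mul1r -mulrA (xP i).2 mulrCA divff// mulr1.
Qed.

(** The value of [kappa] makes the ratios [b i / a i] in [1, kappa[ exactly those that
    [exists_means] can reach. It depends on the exponent alone, so the same bound serves all points
    of a segment. *)
Lemma mean_step (p q : R) (f : R -> R) : 0 < p ->
  ((1 < q /\
    forall (n : nat) (A B : 'M[R[i]]_n), posdefmx A -> posdefmx B ->
      loewner_le (mxfun f (arith_mean A B)) (mxfun f (mu_mean q A B)))
   \/
   (p < 1 /\
    forall (n : nat) (A B : 'M[R[i]]_n), posdefmx A -> posdefmx B ->
      loewner_le (mxfun f (mu_mean p A B)) (mxfun f (arith_mean A B)))) ->
  exists2 kappa, 1 < kappa & forall n (S : 'M[R[i]]_n) (a b : 'I_n -> R),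
    S \in unitmx -> (forall i, 0 < a i) ->
    (forall i, a i <= b i < kappa * a i) ->
    loewner_le (mxfun f (congdiag S a)) (mxfun f (congdiag S b)).
Proof.
have pow1 r : 1 `^ r = 1 :> R by rewrite powR1.
have pow_gt1 r : 0 < r -> 1 < 2 `^ r :> R.
  by move=> r_gt0; rewrite -[ltLHS](pow1 r) gt0_ltr_powR ?nnegrE// ltr1n.
move=> p_gt0 [[q_gt1 le_f]|[p_lt1 le_f]].
- have q_gt0 : 0 < q by lra.
  (* This is 2^(1 - 1/q), the limit of the power mean of order [q] of x and 2 - x as x tends to
     0. *)
  exists (2 `^ ((q - 1) / q)) => [|n S a b Su a_gt0 ab].
    by apply: pow_gt1; rewrite divr_gt0 ?subr_gt0.
  have b_gt0 i : 0 < b i by have := ab i; have := a_gt0 i; lra.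
  have ratio_gt0 i : 0 < b i / a i by apply: divr_gt0.
  have [|X [Y [Xpos Ypos <- <-]]] := exists_means q_gt0 Su a_gt0 b_gt0.
    move=> i; right; have /andP[ab1 ab2] := ab i; apply/andP; split.
      rewrite -[leLHS](pow1 q) ge0_ler_powR ?nnegrE ?(ltW q_gt0)
        ?(ltW (ratio_gt0 i))//.
      by rewrite ler_pdivlMr// mul1r.
    have -> : 2 `^ (q - 1) = (2 `^ ((q - 1) / q)) `^ q.
      by rewrite -powRrM divfK// gt_eqF.
    rewrite gt0_ltr_powR ?nnegrE ?powR_ge0 ?(ltW (ratio_gt0 i))//.
    by rewrite ltr_pdivrMr.
  exact: le_f.
(* The inequality now goes from the power mean to the arithmetic mean, so [a] and [b] exchange
   roles; [kappa] is the inverse of the limit 2^(1 - 1/p), which bounds [a i / b i] from below. *)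
- exists (2 `^ ((1 - p) / p)) => [|n S a b Su a_gt0 ab].
    by apply: pow_gt1; rewrite divr_gt0 ?subr_gt0.
  have b_gt0 i : 0 < b i by have := ab i; have := a_gt0 i; lra.
  have ratio_gt0 i : 0 < a i / b i by apply: divr_gt0.
  have [|X [Y [Xpos Ypos <- <-]]] := exists_means p_gt0 Su b_gt0 a_gt0.
    move=> i; left; have /andP[ab1 ab2] := ab i; apply/andP; split; last first.
      rewrite -[leRHS](pow1 p) ge0_ler_powR ?nnegrE ?(ltW p_gt0)
        ?(ltW (ratio_gt0 i))//.
      by rewrite ler_pdivrMr// mul1r.
    have -> : 2 `^ (p - 1) = ((2 `^ ((1 - p) / p))^-1) `^ p.
      by rewrite -powRN -powRrM mulNr divfK ?gt_eqF// opprB.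
    rewrite gt0_ltr_powR ?nnegrE ?invr_ge0 ?powR_ge0 ?(ltW (ratio_gt0 i))//.
    by rewrite ltr_pdivlMr// mulrC ltr_pdivrMr ?powR_gt0// mulrC.
  exact: le_f.
Qed.

End PowerMean.

Theorem theorem3 (R : realType) (p q : R) (f : R -> R)
    (p_gt0 : 0 < p) (p_le1 : p <= 1) (q_ge1 : 1 <= q)
    (f_cont : {within `[0, +oo[, continuous f})
    (f_mean :
      (1 < q /\
       forall (n : nat) (A B : 'M[R[i]]_n), posdefmx A -> posdefmx B ->
         loewner_le (mxfun f (arith_mean A B)) (mxfun f (mu_mean q A B)))
      \/
      (p < 1 /\
       forall (n : nat) (A B : 'M[R[i]]_n), posdefmx A -> posdefmx B ->
         loewner_le (mxfun f (mu_mean p A B)) (mxfun f (arith_mean A B)))) :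
  operator_monotone `]0, +oo[ f.
Proof.
split.
  apply: continuous_subspaceW f_cont => x /=.
  by rewrite !in_itv /= !andbT => /ltW.
have [kappa kappa_gt1 step] := mean_step p_gt0 f_mean.
move=> n A B Ah Bh Apos _.
have [S Su [-> [d ->]]] := simultaneous_congdiag Ah Bh Apos => AB.
(* In the common coordinates [A] is the identity and [B] is diagonal, so the Loewner inequality is
   entrywise. *)
have d_ge1 i : 1 <= d i.
  rewrite -subr_ge0; apply: (psd_congdiag (d := fun i => d i - 1) Su).
  have -> : congdiag S (fun i => d i - 1) =
      congdiag S d - congdiag S (fun=> 1); last exact: AB.
  apply/eqP; rewrite eq_sym subr_eq congdiagD; apply/eqP.
  by congr congdiag; apply/funext => j; rewrite subrK.
(* The sum stands in for a maximum: its terms are nonnegative, so each is at most [M]. The successor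
   in [N] makes the bound strict and [N] positive. *)
pose M := \sum_i (d i - 1) / (kappa - 1).
pose N := (Num.truncn M).+1.
have N_gt0 : 0 < N%:R :> R by rewrite ltr0n.
have d_lt i : (d i - 1) / N%:R < kappa - 1.
  have k_gt0 : 0 < kappa - 1 by lra.
  rewrite ltr_pdivrMr// mulrC -ltr_pdivrMr//.
  apply: le_lt_trans (truncnS_gt M); rewrite /M (bigD1 i)//= lerDl sumr_ge0//.
  by move=> j _; rewrite divr_ge0 ?subr_ge0// ltW.
(* [congdiag S (a k)] is the point at parameter k/N of the segment from [A] to [B]. *)
pose a k i := 1 + k%:R * ((d i - 1) / N%:R).
have t_ge0 i : 0 <= (d i - 1) / N%:R by rewrite divr_ge0 ?subr_ge0// ltW.
have a_ge1 k i : 1 <= a k i by rewrite lerDl mulr_ge0.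
have -> : (fun=> 1) = a 0 by apply/funext => i; rewrite /a mul0r addr0.
have -> : d = a N.
  by apply/funext => i; rewrite /a mulrC divfK ?gt_eqF// addrC subrK.
apply: (loewner_chain (X := fun k => mxfun f (congdiag S (a k)))) => k _.
apply: step => // i; first by apply: lt_le_trans (a_ge1 k i).
have aS : a k.+1 i = a k i + (d i - 1) / N%:R.
  by rewrite /a -natr1 mulrDl mul1r addrA.
(* The increment is below [kappa - 1], hence below [(kappa - 1) * a k i] since [a k i] is at least
   1. *)
rewrite aS lerDl t_ge0/=; have := d_lt i; have := a_ge1 k i.
nra.
Qed.
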